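(* Let $I\subset\mathbb{R}$ be an open interval and let $\alpha: I\to E^3$ be a smooth unit speed curve with nowhere zero curvature $\kappa$ and nowhere zero torsion $\tau$. Let $\widetilde{B}$ be the spherical binormal indicatrix of $\alpha$ and let $\{T^{*},N^{*},B^{*}\}$ be the Frenet frame of the curve $\widetilde{B}$. Then $\alpha$ is a slant helix if and only if $$\frac{\|D_{T}B^{*}\|}{\|D_{T}T^{*}\|}$$ is constant along the curve, where $D_T$ denotes differentiation along the curve.
   Context: $E^3$ is Euclidean 3-space. For a unit speed curve $\alpha$ with Frenet vectors $T_\alpha=\alpha'$, $N_\alpha=T_\alpha'/\|T_\alpha'\|$, $B_\alpha=T_\alpha\times N_\alpha$, the curvature $\kappa$ and torsion $\tau$ are given by $T_\alpha'=\kappa N_\alpha$, $N_\alpha'=-\kappa T_\alpha+\tau B_\alpha$, $B_\alpha'=-\tau N_\alpha$. The (spherical) binormal indicatrix of $\alpha$ is the curve $\widetilde{B}(s)=B_\alpha(s)$ on the unit sphere centred at the origin; it is regular because $\tau\neq 0$. Its Frenet frame $\{T^*,N^*,B^*\}$ consists of its unit tangent, principal normal and binormal as a curve in $E^3$. $D_T$ is the derivative of these vector fields along the curve with respect to the arclength parameter $s$ of $\alpha$ (using the arclength of $\widetilde{B}$ instead gives the same quotient). A curve with nonvanishing curvature is a slant helix if its principal normal makes a constant angle with some fixed direction; equivalently, the function $\sigma=\frac{\kappa^2}{(\kappa^2+\tau^2)^{3/2}}\left(\frac{\tau}{\kappa}\right)'$ is constant. *)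

(* Defs.v *)
From mathcomp Require Import all_boot all_order all_algebra.
From mathcomp Require Import all_classical all_reals all_analysis.

Set Implicit Arguments.
Unset Strict Implicit.
Unset Printing Implicit Defensive.

Import Order.TTheory GRing.Theory Num.Theory.
Import numFieldNormedType.Exports.

Local Open Scope ring_scope.
Local Open Scope classical_set_scope.

(* E^3 is 'rV[R]_3. The norm `|v| that MathComp-Analysis puts on row vectors is
   the max norm; it is used only through its topology, to differentiate curves.
   Lengths are measured by the Euclidean norm enorm. *)

Definition dot (R : realType) (u v : 'rV[R]_3) : R := (u *m v^T) 0 0.

Definition enorm (R : realType) (u : 'rV[R]_3) : R := Num.sqrt (dot u u).

(* Index arithmetic in 'I_3 is modulo 3. *)
Definition cross (R : realType) (u v : 'rV[R]_3) : 'rV[R]_3 :=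
  \row_(j < 3) (u 0 (j + 1) * v 0 (j + 2) - u 0 (j + 2) * v 0 (j + 1)).

Definition normalize (R : realType) (u : 'rV[R]_3) : 'rV[R]_3 :=
  (enorm u)^-1 *: u.

(* Unoriented angle in [0, pi] between two nonzero vectors. *)
Definition angle (R : realType) (u v : 'rV[R]_3) : R :=
  acos (dot u v / (enorm u * enorm v)).

Definition smooth_on (R : realType) (I : set R) (g : R -> 'rV[R]_3) : Prop :=
  forall (n : nat) (s : R), I s -> derivable (derive1n n g) s 1.

Definition unit_speed_on (R : realType) (I : set R) (g : R -> 'rV[R]_3) : Prop :=
  forall s : R, I s -> enorm (derive1 g s) = 1.

Definition constant_on (R : realType) (T : Type) (I : set R) (f : R -> T) : Prop :=
  exists c : T, forall s : R, I s -> f s = c.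

(* Frenet frame of a regular curve in an arbitrary parametrization; for a unit
   speed curve the denominator in the tangent is 1. *)

Definition frenetT (R : realType) (g : R -> 'rV[R]_3) (s : R) : 'rV[R]_3 :=
  normalize (derive1 g s).

Definition frenetN (R : realType) (g : R -> 'rV[R]_3) (s : R) : 'rV[R]_3 :=
  normalize (derive1 (frenetT g) s).

Definition frenetB (R : realType) (g : R -> 'rV[R]_3) (s : R) : 'rV[R]_3 :=
  cross (frenetT g s) (frenetN g s).

(* For unit speed curves only: kappa and tau are the coefficients in the Frenet
   equations T' = kappa N and B' = - tau N. *)

Definition curvature (R : realType) (g : R -> 'rV[R]_3) (s : R) : R :=
  enorm (derive1 (frenetT g) s).

Definition torsion (R : realType) (g : R -> 'rV[R]_3) (s : R) : R :=
  - dot (derive1 (frenetB g) s) (frenetN g s).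

(* Meant for curves with nonvanishing curvature, so that N is a unit vector. *)
Definition slant_helix (R : realType) (I : set R) (g : R -> 'rV[R]_3) : Prop :=
  exists2 u : 'rV[R]_3, u != 0 & constant_on I (fun s => angle (frenetN g s) u).

Definition binormal_indicatrix (R : realType) (g : R -> 'rV[R]_3) :
    R -> 'rV[R]_3 :=
  frenetB g.

(* Main.v *)
Require Import Defs.
From mathcomp Require Import all_boot all_order all_algebra.
From mathcomp Require Import all_classical all_reals all_analysis.
From mathcomp Require Import ring.
Import Order.TTheory GRing.Theory Num.Theory.
Import numFieldNormedType.Exports.
Local Open Scope ring_scope.
Local Open Scope classical_set_scope.

Set Implicit Arguments.
Unset Strict Implicit.
Unset Printing Implicit Defensive.

(** The principal normal of alpha is, up to sign, the unit tangent of its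
    binormal indicatrix.  Indeed B' = - tau N, and tau keeps a constant sign on
    an interval on which it does not vanish, so that T* = e N with e = 1 or
    e = -1.  Hence alpha is a slant helix exactly when T* makes a constant angle
    with a fixed direction, that is, when the binormal indicatrix is a general
    helix, and the claim becomes Lancret's theorem for that curve: |T*'| and
    |B*'| are its curvature and the absolute value of its torsion, both
    multiplied by its speed, and a curve is a general helix iff the quotient of
    torsion by curvature is constant.  Absolute values do no harm here, because
    a continuous torsion with constant |tau| / kappa is either zero everywhere
    or of constant sign.

    Lancret's theorem is proved for any orthonormal frame with T' = kappa N and
    kappa > 0, in an arbitrary parametrization ([Frenet_frame], [Lancret]).
    The other two Frenet equations follow from orthonormality
    ([frame_dN], [frame_dB]).  If <T, u> = c is constant, two differentiations
    give <N, u> = 0 and kappa c = tau <B, u>, whereas <B, u>^2 = |u|^2 - c^2 is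
    constant; conversely, if tau = m kappa, the vector m T + B is constant and
    is the axis.

    The frames of alpha and of its indicatrix are obtained by differentiating
    and normalizing in turn, so smoothness has to be propagated.  This is
    done with n-fold differentiability on an open set, which is preserved by
    every product satisfying the Leibniz rule
    ([ntimes_derivable_Leibniz]) and by v |-> 1 / |v|
    ([ntimes_derivable_inv_enorm]). *)

(** * Euclidean vector algebra *)

Lemma dot3E (R : realType) (u v : 'rV[R]_3) :
  dot u v = u 0 0 * v 0 0 + u 0 1 * v 0 1 + u 0 (1 + 1) * v 0 (1 + 1).
Proof.
rewrite /dot mxE !big_ord_recl big_ord0 addr0 addrA !mxE.
by congr (_ + u 0 _ * v 0 _ + u 0 _ * v 0 _); exact/val_inj.
Qed.

Lemma row3P (R : realType) (u v : 'rV[R]_3) :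
  u 0 0 = v 0 0 -> u 0 1 = v 0 1 -> u 0 (1 + 1) = v 0 (1 + 1) -> u = v.
Proof.
move=> uv0 uv1 uv2; apply/rowP => -[[|[|[|//]]] lt_i3].
- by rewrite (_ : Ordinal _ = 0)//; exact/val_inj.
- by rewrite (_ : Ordinal _ = 1)//; exact/val_inj.
- by rewrite (_ : Ordinal _ = 1 + 1)//; exact/val_inj.
Qed.

Lemma cross3E (R : realType) (u v : 'rV[R]_3) :
  [/\ cross u v 0 0 = u 0 1 * v 0 (1 + 1) - u 0 (1 + 1) * v 0 1,
      cross u v 0 1 = u 0 (1 + 1) * v 0 0 - u 0 0 * v 0 (1 + 1) &
      cross u v 0 (1 + 1) = u 0 0 * v 0 1 - u 0 1 * v 0 0].
Proof.
by split; rewrite mxE; congr (u 0 _ * v 0 _ - u 0 _ * v 0 _); exact/val_inj.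
Qed.

Lemma dotC (R : realType) (u v : 'rV[R]_3) : dot u v = dot v u.
Proof. by rewrite !dot3E; ring. Qed.

Lemma dotDl (R : realType) (u v w : 'rV[R]_3) :
  dot (u + v) w = dot u w + dot v w.
Proof. by rewrite !dot3E !mxE; ring. Qed.

Lemma dotZl (R : realType) (a : R) (u w : 'rV[R]_3) :
  dot (a *: u) w = a * dot u w.
Proof. by rewrite !dot3E !mxE; ring. Qed.

Lemma dotDr (R : realType) (u v w : 'rV[R]_3) :
  dot w (u + v) = dot w u + dot w v.
Proof. by rewrite !(dotC w) dotDl. Qed.

Lemma dotZr (R : realType) (a : R) (u w : 'rV[R]_3) :
  dot w (a *: u) = a * dot w u.
Proof. by rewrite !(dotC w) dotZl. Qed.

Lemma dot0l (R : realType) (u : 'rV[R]_3) : dot 0 u = 0.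
Proof. by rewrite -(scale0r 0) dotZl mul0r. Qed.

Lemma dot_ge0 (R : realType) (u : 'rV[R]_3) : 0 <= dot u u.
Proof. by rewrite dot3E -!expr2 !addr_ge0// sqr_ge0. Qed.

Lemma dot_eq0 (R : realType) (u : 'rV[R]_3) : (dot u u == 0) = (u == 0).
Proof.
apply/eqP/eqP => [|->]; last by rewrite dot0l.
rewrite dot3E -!expr2 => /eqP.
rewrite !paddr_eq0 ?addr_ge0 ?sqr_ge0// !sqrf_eq0.
by move=> /andP[/andP[/eqP u0 /eqP u1] /eqP u2]; apply: row3P; rewrite mxE.
Qed.

Lemma dot_gt0 (R : realType) (u : 'rV[R]_3) : u != 0 -> 0 < dot u u.
Proof. by rewrite lt0r dot_eq0 dot_ge0 andbT. Qed.

Lemma enorm_gt0 (R : realType) (u : 'rV[R]_3) : u != 0 -> 0 < enorm u.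
Proof. by rewrite sqrtr_gt0; exact: dot_gt0. Qed.

Lemma enorm_eq0 (R : realType) (u : 'rV[R]_3) : (enorm u == 0) = (u == 0).
Proof.
have [->|/enorm_gt0/gt_eqF//] := eqVneq u 0.
by rewrite /enorm dot0l sqrtr0 eqxx.
Qed.

Lemma sqr_enorm (R : realType) (u : 'rV[R]_3) : enorm u ^+ 2 = dot u u.
Proof. exact/sqr_sqrtr/dot_ge0. Qed.

Lemma enormZ (R : realType) (a : R) (u : 'rV[R]_3) :
  enorm (a *: u) = `|a| * enorm u.
Proof.
by rewrite /enorm dotZl dotZr mulrA -expr2 sqrtrM ?sqr_ge0// sqrtr_sqr.
Qed.

Lemma dot_normalize (R : realType) (u : 'rV[R]_3) :
  u != 0 -> dot (normalize u) (normalize u) = 1.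
Proof.
move=> u_neq0; have /lt0r_neq0 nu := enorm_gt0 u_neq0.
by rewrite dotZl dotZr -sqr_enorm mulrA -expr2 exprVn mulVf// expf_neq0.
Qed.

Lemma enormK (R : realType) (u : 'rV[R]_3) : enorm u *: normalize u = u.
Proof.
have [->|/enorm_gt0/lt0r_neq0 nu] := eqVneq u 0.
  by rewrite /normalize !scaler0.
by rewrite scalerA mulfV// scale1r.
Qed.

Lemma normalizeZ_unit (R : realType) (a : R) (u : 'rV[R]_3) :
  dot u u = 1 -> normalize (a *: u) = Num.sg a *: u.
Proof.
move=> uu; rewrite /normalize enormZ /enorm uu sqrtr1 mulr1 scalerA.
have [->|a0] := eqVneq a 0; first by rewrite sgr0 mulr0.
congr (_ *: _); rewrite [X in _ * X]numEsg mulrCA mulVf ?mulr1//.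
by rewrite normr_eq0.
Qed.

(** Lagrange's identity. *)
Lemma dot_cross_self (R : realType) (u v : 'rV[R]_3) :
  dot (cross u v) (cross u v) = dot u u * dot v v - dot u v ^+ 2.
Proof.
by rewrite !dot3E; have [-> -> ->] := cross3E u v; ring.
Qed.

Lemma Cauchy_Schwarz (R : realType) (u v : 'rV[R]_3) :
  `|dot u v| <= enorm u * enorm v.
Proof.
rewrite -sqrtrM ?dot_ge0// -sqrtr_sqr ler_wsqrtr// -subr_ge0.
by rewrite -dot_cross_self dot_ge0.
Qed.

Lemma dot_crossl (R : realType) (u v : 'rV[R]_3) : dot (cross u v) u = 0.
Proof. by rewrite dot3E; have [-> -> ->] := cross3E u v; ring. Qed.

Lemma dot_crossr (R : realType) (u v : 'rV[R]_3) : dot (cross u v) v = 0.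
Proof. by rewrite dot3E; have [-> -> ->] := cross3E u v; ring. Qed.

Lemma crossvv (R : realType) (u : 'rV[R]_3) : cross u u = 0.
Proof.
by have [c0 c1 c2] := cross3E u u; apply: row3P; rewrite ?c0 ?c1 ?c2 mxE; ring.
Qed.

Lemma crossZl (R : realType) (a : R) (u v : 'rV[R]_3) :
  cross (a *: u) v = a *: cross u v.
Proof. by apply/rowP => i; rewrite !mxE; ring. Qed.

Lemma crossZr (R : realType) (a : R) (u v : 'rV[R]_3) :
  cross u (a *: v) = a *: cross u v.
Proof. by apply/rowP => i; rewrite !mxE; ring. Qed.

Lemma crossDr (R : realType) (u v w : 'rV[R]_3) :
  cross w (u + v) = cross w u + cross w v.
Proof. by apply/rowP => i; rewrite !mxE; ring. Qed.

(** The Grassmann identity for the vector triple product. *)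
Lemma cross_crossr (R : realType) (u v w : 'rV[R]_3) :
  cross u (cross v w) = dot u w *: v - dot u v *: w.
Proof.
have [c0 c1 c2] := cross3E v w; have [d0 d1 d2] := cross3E u (cross v w).
apply: row3P; rewrite ?d0 ?d1 ?d2 ?c0 ?c1 ?c2 !mxE !dot3E; ring.
Qed.

(** The triple product formulas give, for arbitrary u and v, the expansion of
    |u x v|^2 x on u, v and u x v; it is a polynomial identity in the
    coordinates, and orthonormality turns it into the claim. *)
Lemma orthonormal_expansion (R : realType) (u v x : 'rV[R]_3) :
    dot u u = 1 -> dot v v = 1 -> dot u v = 0 ->
  x = dot x u *: u + dot x v *: v + dot x (cross u v) *: cross u v.
Proof.
move=> uu vv uv.
have expand : dot (cross u v) (cross u v) *: x =
    (dot x u * dot v v - dot x v * dot u v) *: u +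
    (dot x v * dot u u - dot x u * dot u v) *: v +
    dot x (cross u v) *: cross u v.
  (* Abstracting u x v keeps its coordinates folded until they are rewritten. *)
  move: (cross u v) (cross3E u v) => c [c0 c1 c2].
  by apply: row3P; rewrite !mxE !dot3E ?c0 ?c1 ?c2; ring.
move: expand; rewrite dot_cross_self uu vv uv.
by rewrite expr2 !mulr0 !mulr1 !subr0 scale1r.
Qed.

Lemma orthonormal_Parseval (R : realType) (u v x : 'rV[R]_3) :
    dot u u = 1 -> dot v v = 1 -> dot u v = 0 ->
  dot x x = dot x u ^+ 2 + dot x v ^+ 2 + dot x (cross u v) ^+ 2.
Proof.
move=> uu vv uv; rewrite [X in dot x X](@orthonormal_expansion _ u v x)//.
by rewrite !dotDr !dotZr.
Qed.

Lemma cross_plane (R : realType) (u v : 'rV[R]_3) (a b : R) :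
  dot u u = 1 -> dot u v = 0 -> cross u (a *: u + b *: cross u v) = - b *: v.
Proof.
move=> uu uv; rewrite crossDr !crossZr crossvv scaler0 add0r cross_crossr uu uv.
by rewrite scale0r sub0r scale1r scalerN scaleNr.
Qed.

(** By the Cauchy-Schwarz inequality the cosines involved lie in the interval on
    which the arc cosine is injective. *)
Lemma angle_inj (R : realType) (u v w : 'rV[R]_3) :
    dot u u = 1 -> dot v v = 1 -> w != 0 ->
  angle u w = angle v w -> dot u w = dot v w.
Proof.
move=> uu vv w_neq0; have w_gt0 := enorm_gt0 w_neq0.
have in_dom x : dot x x = 1 -> dot x w / (enorm x * enorm w) \in `[-1, 1]%R.
  move=> xx; rewrite in_itv/= -ler_norml /enorm xx sqrtr1 mul1r.
  rewrite normrM normfV (gtr0_norm w_gt0) ler_pdivrMr// mul1r.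
  by have := Cauchy_Schwarz x w; rewrite {1}/enorm xx sqrtr1 mul1r.
rewrite /angle => /(congr1 cos); rewrite !acosK ?in_dom//.
by rewrite {1 3}/enorm uu vv sqrtr1 mul1r; apply/mulIf; rewrite invr_eq0 gt_eqF.
Qed.

(** * Derivatives of vector-valued functions *)

Lemma is_derive_rowP (R : realType) (f : R -> 'rV[R]_3) (df : 'rV[R]_3)
    (s : R) :
  is_derive s 1 f df <->
  forall i, is_derive s 1 (fun t => f t 0 i) (df 0 i).
Proof.
split=> [[f_s <-] i|f_s].
  have fi_s := (derivable_mxP f s 1).1 f_s 0 i.
  by rewrite derive_mx// mxE; exact/derivableP.
have f_drv : derivable f s 1.
  by apply/derivable_mxP => i j; rewrite ord1; have [] := f_s j.
split=> //; rewrite derive_mx//; apply/rowP => j; rewrite mxE.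
by have [] := f_s j.
Qed.

Lemma is_derive_dot (R : realType) (f g : R -> 'rV[R]_3) (df dg : 'rV[R]_3)
    (s : R) :
  is_derive s 1 f df -> is_derive s 1 g dg ->
  is_derive s 1 (fun t => dot (f t) (g t)) (dot df (g s) + dot (f s) dg).
Proof.
move=> /is_derive_rowP f_s /is_derive_rowP g_s.
rewrite (_ : (fun t => _) = (fun t => f t 0 0 * g t 0 0) +
    (fun t => f t 0 1 * g t 0 1) + (fun t => f t 0 (1 + 1) * g t 0 (1 + 1))).
  apply: is_derive_eq; rewrite !dot3E /GRing.scale/=; ring.
by apply/funext => t; rewrite dot3E.
Qed.

Lemma is_derive_cross (R : realType) (f g : R -> 'rV[R]_3) (df dg : 'rV[R]_3)
    (s : R) :
  is_derive s 1 f df -> is_derive s 1 g dg ->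
  is_derive s 1 (fun t => cross (f t) (g t)) (cross df (g s) + cross (f s) dg).
Proof.
move=> /is_derive_rowP f_s /is_derive_rowP g_s; apply/is_derive_rowP => i.
under eq_fun do rewrite mxE.
by apply: is_derive_eq; rewrite !mxE /GRing.scale/=; ring.
Qed.

Lemma is_derive_scale (R : realType) (a : R -> R) (g : R -> 'rV[R]_3) (da : R)
    (dg : 'rV[R]_3) (s : R) :
  is_derive s 1 a da -> is_derive s 1 g dg ->
  is_derive s 1 (fun t => a t *: g t) (da *: g s + a s *: dg).
Proof.
move=> a_s /is_derive_rowP g_s; apply/is_derive_rowP => i.
under eq_fun do rewrite mxE.
by apply: is_derive_eq; rewrite !mxE /GRing.scale/=; ring.
Qed.

Lemma is_derive_inv_enorm (R : realType) (g : R -> 'rV[R]_3) (dg : 'rV[R]_3)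
    (s : R) :
  g s != 0 -> is_derive s 1 g dg ->
  is_derive s 1 (fun t => (enorm (g t))^-1)
    (- (dot (g s) dg * (enorm (g s))^-1 ^+ 3)).
Proof.
move=> gs_neq0 g_s; have ns := lt0r_neq0 (enorm_gt0 gs_neq0).
have norm_s : is_derive s 1 (fun t => enorm (g t)) (dot (g s) dg / enorm (g s)).
  apply: (is_derive_eq (is_derive1_comp (is_derive1_sqrt (dot_gt0 gs_neq0))
    (is_derive_dot g_s g_s))).
  rewrite -[Num.sqrt _]/(enorm (g s)) (dotC dg); field.
  exact: ns.
apply: (is_derive_eq (@is_deriveV _ (fun t => enorm (g t)) _ _ _ ns norm_s)).
rewrite /GRing.scale/=; field.
exact: ns.
Qed.

(** * Smoothness on an open set *)

Section smoothness.
Context {R : realType} (I : set R).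
Hypothesis I_open : open I.

(** Peeling off the first derivative, rather than the last one, is what lets the
    stability lemmas below go by induction on the order: the derivative of a
    product is a sum of products of the same kind. *)
Fixpoint ntimes_derivable (V : normedModType R) (n : nat) (f : R -> V) : Prop :=
  if n is m.+1 then
    (forall s, I s -> derivable f s 1) /\ ntimes_derivable m (derive1 f)
  else True.

Lemma ntimes_derivableP (V : normedModType R) (f : R -> V) :
  (forall n, ntimes_derivable n f) <->
  (forall n s, I s -> derivable (derive1n n f) s 1).
Proof.
split=> [f_drv n|f_drv n]; elim: n f f_drv => [|n IHn] f f_drv//.
- by have [] := f_drv 1%N.
- by move=> s; rewrite derive1Sn; apply: IHn => m; have [] := f_drv m.+1.
- split; first exact: (f_drv 0%N).
  by apply: IHn => m s; rewrite -derive1Sn; exact: f_drv.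
Qed.

Lemma near_eq_on {T : Type} (f g : R -> T) (s : R) :
  I s -> (forall t, I t -> f t = g t) -> \near s, f s = g s.
Proof. by move=> Is fg; apply: filterS (open_nbhs_nbhs (conj I_open Is)). Qed.

Lemma derive1_eq_on (V : normedModType R) (f g : R -> V) (s : R) :
  I s -> (forall t, I t -> f t = g t) -> derive1 f s = derive1 g s.
Proof. by move=> Is fg; rewrite !derive1E; exact/near_eq_derive/near_eq_on. Qed.

Lemma ntimes_derivable_eq_on (V : normedModType R) n (f g : R -> V) :
  (forall t, I t -> f t = g t) -> ntimes_derivable n f -> ntimes_derivable n g.
Proof.
elim: n f g => [//|n IHn] f g fg [f_drv f'_drv]; split => [s Is|].
  exact: near_eq_derivable (near_eq_on Is fg) (f_drv s Is).
by apply: IHn f'_drv => t It; exact: derive1_eq_on.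
Qed.

Lemma ntimes_derivableS (V : normedModType R) n (f df : R -> V) :
  (forall s, I s -> is_derive s 1 f (df s)) -> ntimes_derivable n df ->
  ntimes_derivable n.+1 f.
Proof.
move=> f_drv df_drv; split=> [s /f_drv[]//|].
by apply: ntimes_derivable_eq_on df_drv => s /f_drv[_ <-]; rewrite derive1E.
Qed.

Lemma ntimes_derivableW (V : normedModType R) n (f : R -> V) :
  ntimes_derivable n.+1 f -> ntimes_derivable n f.
Proof. by elim: n f => [//|n IHn] f [f_drv /IHn f'_drv]; split. Qed.

Lemma ntimes_derivable_is_derive (V : normedModType R) n (f : R -> V) s :
  ntimes_derivable n.+1 f -> I s -> is_derive s 1 f (derive1 f s).
Proof. by move=> [f_drv _] /f_drv ?; rewrite derive1E; exact/derivableP. Qed.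

Lemma ntimes_derivableD (V : normedModType R) n (f g : R -> V) :
  ntimes_derivable n f -> ntimes_derivable n g ->
  ntimes_derivable n (fun t => f t + g t).
Proof.
elim: n f g => [//|n IHn] f g f_n g_n.
apply: (@ntimes_derivableS _ _ _ (fun s => derive1 f s + derive1 g s)).
  move=> s Is; apply: is_deriveD.
    exact: (ntimes_derivable_is_derive f_n).
  exact: (ntimes_derivable_is_derive g_n).
by apply: IHn; [case: f_n|case: g_n].
Qed.

(** One induction covers all bilinear operations in use: products of scalars,
    scaling, dot and cross products. *)
Lemma ntimes_derivable_Leibniz (U V W : normedModType R) (B : U -> V -> W) n
    (f : R -> U) (g : R -> V) :
    (forall f g df dg s, is_derive s (1 : R) f df -> is_derive s 1 g dg ->
       is_derive s 1 (fun t => B (f t) (g t)) (B df (g s) + B (f s) dg)) ->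
  ntimes_derivable n f -> ntimes_derivable n g ->
  ntimes_derivable n (fun t => B (f t) (g t)).
Proof.
move=> Leibniz; elim: n f g => [//|n IHn] f g f_n g_n.
apply: (@ntimes_derivableS _ _ _
  (fun s => B (derive1 f s) (g s) + B (f s) (derive1 g s))).
  move=> s Is; apply: Leibniz.
    exact: (ntimes_derivable_is_derive f_n).
  exact: (ntimes_derivable_is_derive g_n).
by apply: ntimes_derivableD; apply: IHn;
  [case: f_n|exact: ntimes_derivableW|exact: ntimes_derivableW|case: g_n].
Qed.

Lemma ntimes_derivableM n (a b : R -> R) :
  ntimes_derivable n a -> ntimes_derivable n b ->
  ntimes_derivable n (fun t => a t * b t).
Proof.
apply: (@ntimes_derivable_Leibniz R R R *%R) => {}a {}b da db s a_s b_s.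
by apply: is_derive_eq; rewrite /GRing.scale/=; ring.
Qed.

Lemma ntimes_derivableN (V : normedModType R) n (f : R -> V) :
  ntimes_derivable n f -> ntimes_derivable n (fun t => - f t).
Proof.
elim: n f => [//|n IHn] f f_n.
apply: (@ntimes_derivableS _ _ _ (fun s => - derive1 f s)).
  by move=> s Is; apply: is_deriveN; exact: (ntimes_derivable_is_derive f_n).
by apply: IHn; case: f_n.
Qed.

Lemma ntimes_derivable_dot n (f g : R -> 'rV[R]_3) :
  ntimes_derivable n f -> ntimes_derivable n g ->
  ntimes_derivable n (fun t => dot (f t) (g t)).
Proof. by apply: ntimes_derivable_Leibniz => *; exact: is_derive_dot. Qed.

(** The derivative of h = 1 / |g| is - <g, g'> h^3, a polynomial in g, g' and h
    itself, so the regularity of h can be bootstrapped from that of g. *)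
Lemma ntimes_derivable_inv_enorm n (g : R -> 'rV[R]_3) :
  (forall s, I s -> g s != 0) -> ntimes_derivable n g ->
  ntimes_derivable n (fun t => (enorm (g t))^-1).
Proof.
move=> g_neq0; elim: n => [//|n IHn] g_n; pose h t : R := (enorm (g t))^-1.
apply: (@ntimes_derivableS _ _ _
  (fun s => - (dot (g s) (derive1 g s) * (h s * (h s * h s))))).
  move=> s Is; have g_s := ntimes_derivable_is_derive g_n Is.
  by apply: (is_derive_eq (is_derive_inv_enorm (g_neq0 s Is) g_s)).
have h_n : ntimes_derivable n h by exact/IHn/ntimes_derivableW.
apply/ntimes_derivableN/ntimes_derivableM.
  by apply: ntimes_derivable_dot; [exact: ntimes_derivableW|case: g_n].
by do 2?[apply: ntimes_derivableM => //].
Qed.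

Lemma smooth_onP (g : R -> 'rV[R]_3) :
  smooth_on I g <-> forall n, ntimes_derivable n g.
Proof. by split=> /ntimes_derivableP. Qed.

Lemma smooth_on_is_derive (g : R -> 'rV[R]_3) s :
  smooth_on I g -> I s -> is_derive s 1 g (derive1 g s).
Proof. by move=> /smooth_onP/(_ 1%N); exact: ntimes_derivable_is_derive. Qed.

Lemma smooth_on_derive1 (g : R -> 'rV[R]_3) :
  smooth_on I g -> smooth_on I (derive1 g).
Proof.
move=> /smooth_onP g_smooth; apply/smooth_onP => n.
by case: (g_smooth n.+1).
Qed.

Lemma smooth_on_cross (f g : R -> 'rV[R]_3) :
  smooth_on I f -> smooth_on I g -> smooth_on I (fun s => cross (f s) (g s)).
Proof.
move=> /smooth_onP f_smooth /smooth_onP g_smooth; apply/smooth_onP => n.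
by apply: ntimes_derivable_Leibniz => // *; exact: is_derive_cross.
Qed.

Lemma smooth_on_normalize (g : R -> 'rV[R]_3) :
  (forall s, I s -> g s != 0) -> smooth_on I g ->
  smooth_on I (fun s => normalize (g s)).
Proof.
move=> g_neq0 /smooth_onP g_smooth; apply/smooth_onP => n.
apply: (@ntimes_derivable_Leibniz R _ _ *:%R).
- by move=> a f da df s; exact: is_derive_scale.
- exact: ntimes_derivable_inv_enorm.
- exact: g_smooth.
Qed.

Lemma is_derive_const_on (f : R -> R) (df c s : R) :
  I s -> is_derive s 1 f df -> (forall t, I t -> f t = c) -> df = 0.
Proof.
move=> Is [_ <-] fc; rewrite -derive1E.
by rewrite (@derive1_eq_on _ _ (fun=> c) _ Is fc) derive1_cst.
Qed.

(** * Consequences of connectedness *)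

Hypothesis I_itv : is_interval I.

Lemma derive0_constant_on (f : R -> R) :
  (forall s, I s -> is_derive s 1 f 0) ->
  forall s t, I s -> I t -> f s = f t.
Proof.
move=> f_drv s t; wlog le_st : s t / s <= t.
  move=> H Is It; have [st|/ltW ts] := leP s t; first exact: H.
  by rewrite (H t s).
move=> Is It; have I_st x : x \in `[s, t]%R -> I x.
  by rewrite in_itv/=; exact: (I_itv Is It).
have [||c _] := @MVT_segment _ f (fun=> 0) _ _ le_st.
- by move=> x x_st; exact/f_drv/I_st/subset_itv_oo_cc.
- apply: derivable_within_continuous => x /I_st Ix.
  by have [] := f_drv x Ix.
- by rewrite mul0r => /eqP; rewrite subr_eq0 => /eqP.
Qed.

Lemma nonvanishing_sg_constant (f : R -> R) :
    (forall s, I s -> derivable f s 1) -> (forall s, I s -> f s != 0) ->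
  forall s t, I s -> I t -> Num.sg (f s) = Num.sg (f t).
Proof.
move=> f_drv f_neq0 s t; wlog le_st : s t / s <= t.
  move=> H Is It; have [st|/ltW ts] := leP s t; first exact: H.
  by rewrite (H t s).
move=> Is It; have I_st x : x \in `[s, t]%R -> I x.
  by rewrite in_itv/=; exact: (I_itv Is It).
have f_cont : {within `[s, t], continuous f}.
  by apply: derivable_within_continuous => x /I_st; exact: f_drv.
have no_zero : ~~ (Num.min (f s) (f t) <= 0 <= Num.max (f s) (f t)).
  apply/negP => /(IVT le_st f_cont)[c /I_st/f_neq0/eqP].
  exact.
case: (ltrgt0P (f s)) (f_neq0 s Is) no_zero => // fs _;
  case: (ltrgt0P (f t)) (f_neq0 t It) => // ft _.
- by rewrite !gtr0_sg.
- by rewrite ge_min le_max (ltW fs) (ltW ft) orbT.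
- by rewrite ge_min le_max (ltW fs) (ltW ft) orbT.
- by rewrite !ltr0_sg.
Qed.

End smoothness.

(** * Frenet frames and Lancret's theorem *)

(** For the frame of a curve the parametrization is arbitrary: kappa and tau are
    the curvature and the torsion multiplied by the speed, which has no effect
    on their quotient.  The orthogonality of T and N and the Frenet equations
    for N' and B' are consequences. *)
Record Frenet_frame (R : realType) (I : set R) (T N B : R -> 'rV[R]_3)
    (kappa tau : R -> R) : Prop := {
  frame_T_smooth : smooth_on I T;
  frame_N_smooth : smooth_on I N;
  frame_TT : forall s, I s -> dot (T s) (T s) = 1;
  frame_NN : forall s, I s -> dot (N s) (N s) = 1;
  frame_B : B = fun s => cross (T s) (N s);
  frame_kappa_gt0 : forall s, I s -> 0 < kappa s;
  frame_dT : forall s, I s -> derive1 T s = kappa s *: N s;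
  frame_tau : tau = fun s => - dot (derive1 B s) (N s) }.

Section Frenet_frame_theory.
Context {R : realType} (I : set R) (T N B : R -> 'rV[R]_3) (kappa tau : R -> R).
Hypothesis I_open : open I.
Hypothesis frame : Frenet_frame I T N B kappa tau.

Let T_smooth := frame_T_smooth frame.
Let N_smooth := frame_N_smooth frame.
Let TT := frame_TT frame.
Let NN := frame_NN frame.
Let kappa_gt0 := frame_kappa_gt0 frame.
Let dT := frame_dT frame.

Lemma frame_B_smooth : smooth_on I B.
Proof. by rewrite (frame_B frame); exact: smooth_on_cross. Qed.

Lemma frame_TB s : dot (T s) (B s) = 0.
Proof. by rewrite (frame_B frame) dotC dot_crossl. Qed.

Lemma frame_NB s : dot (N s) (B s) = 0.
Proof. by rewrite (frame_B frame) dotC dot_crossr. Qed.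

Lemma frame_TN s : I s -> dot (T s) (N s) = 0.
Proof.
move=> Is; have T_s := smooth_on_is_derive T_smooth Is.
have /eqP := is_derive_const_on I_open Is (is_derive_dot T_s T_s) TT.
rewrite (dotC _ (T s)) -mulr2n mulrn_eq0/= dT// dotZr.
by rewrite mulf_eq0 gt_eqF ?kappa_gt0// => /eqP.
Qed.

Lemma frame_BB s : I s -> dot (B s) (B s) = 1.
Proof.
move=> Is; rewrite (frame_B frame) dot_cross_self TT// NN// frame_TN//.
by rewrite expr0n/= mulr1 subr0.
Qed.

(** The coefficient of B is left as <N', B>: its identification with tau, in
    [frame_dN], rests on the equation for B', which is derived from this one. *)
Lemma frame_dN_BN s :
  I s -> derive1 N s = - kappa s *: T s + dot (derive1 N s) (B s) *: B s.
Proof.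
move=> Is; have T_s := smooth_on_is_derive T_smooth Is.
have N_s := smooth_on_is_derive N_smooth Is.
have /eqP := is_derive_const_on I_open Is (is_derive_dot T_s N_s) frame_TN.
rewrite dT// dotZl NN// mulr1 addrC addr_eq0 => /eqP TdN.
have /eqP := is_derive_const_on I_open Is (is_derive_dot N_s N_s) NN.
rewrite (dotC _ (N s)) -mulr2n mulrn_eq0/= => /eqP NdN.
rewrite {1}(orthonormal_expansion (derive1 N s) (TT Is) (NN Is) (frame_TN Is)).
by rewrite (dotC _ (T s)) TdN (dotC _ (N s)) NdN scale0r addr0 (frame_B frame).
Qed.

(** Since T' is parallel to N, only T x N' remains of (T x N)'. *)
Lemma frame_dB s : I s -> derive1 B s = - tau s *: N s.
Proof.
move=> Is; have T_s := smooth_on_is_derive T_smooth Is.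
have N_s := smooth_on_is_derive N_smooth Is.
have dB : derive1 B s = - dot (derive1 N s) (B s) *: N s.
  have [_] := is_derive_cross T_s N_s; rewrite -derive1E -(frame_B frame) => ->.
  rewrite dT// crossZl crossvv scaler0 add0r {1}frame_dN_BN//.
  by rewrite {2}(frame_B frame) cross_plane ?TT ?frame_TN.
by rewrite (frame_tau frame) dB dotZl NN// mulr1 opprK.
Qed.

Lemma frame_dN s : I s -> derive1 N s = - kappa s *: T s + tau s *: B s.
Proof.
move=> Is; rewrite {1}frame_dN_BN//; congr (_ + _ *: _).
have N_s := smooth_on_is_derive N_smooth Is.
have B_s := smooth_on_is_derive frame_B_smooth Is.
have /eqP := is_derive_const_on I_open Is (is_derive_dot N_s B_s)
  (fun t _ => frame_NB t).
by rewrite addr_eq0 => /eqP ->; rewrite frame_dB// dotZr NN// mulr1 opprK.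
Qed.

Lemma frame_tau_derivable s : I s -> derivable tau s 1.
Proof.
move=> Is.
have dB_s := smooth_on_is_derive (smooth_on_derive1 frame_B_smooth) Is.
have N_s := smooth_on_is_derive N_smooth Is.
by rewrite (frame_tau frame); have [] := is_deriveN (is_derive_dot dB_s N_s).
Qed.

Lemma enorm_frame_dT s : I s -> enorm (derive1 T s) = kappa s.
Proof.
move=> Is; rewrite dT// enormZ /enorm NN// sqrtr1 mulr1.
exact/gtr0_norm/kappa_gt0.
Qed.

Lemma enorm_frame_dB s : I s -> enorm (derive1 B s) = `|tau s|.
Proof.
by move=> Is; rewrite frame_dB// enormZ normrN /enorm NN// sqrtr1 mulr1.
Qed.

Lemma frame_dN_neq0 s : I s -> derive1 N s != 0.
Proof.
move=> Is; apply/eqP => dN0; have := frame_dN Is.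
rewrite dN0 => /(congr1 (fun v => dot v (T s))).
rewrite dot0l dotDl !dotZl TT// (dotC (B s)) frame_TB mulr0 addr0 mulr1.
by move=> /esym/eqP; rewrite oppr_eq0 gt_eqF// kappa_gt0.
Qed.

Hypothesis I_itv : is_interval I.

(** As T is a unit vector, <T, u> is constant exactly when T makes a constant
    angle with u; the quotient of norms is |tau| / kappa. *)
Theorem Lancret :
  (exists2 u : 'rV[R]_3, u != 0 & constant_on I (fun s => dot (T s) u)) <->
  constant_on I (fun s => enorm (derive1 B s) / enorm (derive1 T s)).
Proof.
split=> [[u u_neq0 [c Tu]]|[c ratio]].
  (* The square root is |<B, u>|, by Parseval's identity and <N, u> = 0. *)
  exists (`|c| / Num.sqrt (dot u u - c ^+ 2)) => s Is.
  rewrite enorm_frame_dB// enorm_frame_dT//.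
  have k_gt0 := kappa_gt0 Is.
  have Nu t : I t -> dot (N t) u = 0.
    move=> It; have T_t := smooth_on_is_derive T_smooth It.
    have /eqP := is_derive_const_on I_open It
      (is_derive_dot T_t (is_derive_cst u _ _)) Tu.
    rewrite (dotC _ 0) dot0l addr0 dT// dotZl.
    by rewrite mulf_eq0 gt_eqF ?kappa_gt0// => /eqP.
  have N_s := smooth_on_is_derive N_smooth Is.
  have := is_derive_const_on I_open Is
    (is_derive_dot N_s (is_derive_cst u _ _)) Nu.
  rewrite (dotC _ 0) dot0l addr0 frame_dN// dotDl !dotZl Tu//.
  rewrite mulNr addrC => /eqP; rewrite subr_eq0 => /eqP tau_kappa.
  have := orthonormal_Parseval u (TT Is) (NN Is) (frame_TN Is).
  have -> : cross (T s) (N s) = B s by rewrite (frame_B frame).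
  rewrite !(dotC u) Tu// Nu// expr0n/= addr0 => /eqP.
  rewrite addrC -subr_eq => /eqP uu; rewrite uu sqrtr_sqr.
  (* If <B, u> = 0, then c = 0 as kappa c = tau <B, u>, and u would vanish. *)
  have Bu_neq0 : dot (B s) u != 0.
    apply/eqP => Bu; move: tau_kappa; rewrite Bu mulr0 => /esym/eqP.
    rewrite mulf_eq0 gt_eqF//= => /eqP c0.
    move/eqP: uu; rewrite Bu c0 expr0n/= subr0 dot_eq0.
    by apply/negP.
  rewrite -[X in _ / X](gtr0_norm k_gt0) -!normf_div; congr (`|_|).
  by apply/eqP; rewrite eqr_div// ?lt0r_neq0// tau_kappa mulrC.
have [[s0 Is0]|I0] := pselect (exists s, I s); last first.
  exists (const_mx 1); last by exists 0 => s Is; case: I0; exists s.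
  by apply/eqP => /rowP/(_ 0); rewrite !mxE => /eqP; rewrite oner_eq0.
have norm_tau s : I s -> `|tau s| = c * kappa s.
  move=> Is; have k_gt0 := kappa_gt0 Is.
  by rewrite -(ratio s Is) enorm_frame_dB// enorm_frame_dT// divfK// gt_eqF.
(* From |tau| = c kappa to tau = m kappa: tau cannot change sign. *)
have [m tauE] : exists m, forall s, I s -> tau s = m * kappa s.
  have [c0|c0] := eqVneq c 0.
    by exists 0 => s /norm_tau /eqP; rewrite c0 mul0r normr_eq0 => /eqP.
  have tau_neq0 s : I s -> tau s != 0.
    by move=> Is; rewrite -normr_eq0 norm_tau// mulf_neq0// gt_eqF// kappa_gt0.
  have sg_tau := nonvanishing_sg_constant I_itv frame_tau_derivable tau_neq0.
  exists (Num.sg (tau s0) * c) => s Is.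
  by rewrite -mulrA -norm_tau// (sg_tau s0 s)// -numEsg.
(* The axis: its derivative is (m kappa - tau) N. *)
pose a s := m *: T s + B s.
have a_cst s : I s -> a s = a s0.
  move=> Is; apply/rowP => i.
  apply: (derive0_constant_on I_itv (f := fun t => a t 0 i)) => // t It.
  have T_t := smooth_on_is_derive T_smooth It.
  have B_t := smooth_on_is_derive frame_B_smooth It.
  have a_t : is_derive t 1 a 0.
    apply: (is_derive_eq (is_deriveD (is_deriveZ m T_t) B_t)).
    rewrite dT// frame_dB// tauE// scalerA -scalerDl subrr.
    by rewrite scale0r.
  by have := (is_derive_rowP _ _ _).1 a_t i; rewrite mxE.
exists (a s0).
  apply/eqP => a0; have : dot (a s0) (B s0) = 1.
    by rewrite dotDl dotZl frame_TB mulr0 add0r frame_BB.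
  by rewrite a0 dot0l => /esym/eqP; rewrite oner_eq0.
exists m => s Is.
by rewrite -(a_cst s Is) dotDr dotZr TT// mulr1 frame_TB addr0.
Qed.

End Frenet_frame_theory.

Lemma frenet_Frenet_frame (R : realType) (I : set R) (g : R -> 'rV[R]_3) :
    open I -> smooth_on I g -> (forall s, I s -> derive1 g s != 0) ->
    (forall s, I s -> derive1 (frenetT g) s != 0) ->
  Frenet_frame I (frenetT g) (frenetN g) (frenetB g) (curvature g) (torsion g).
Proof.
move=> I_open g_smooth dg_neq0 dT_neq0.
have T_smooth : smooth_on I (frenetT g).
  exact: (smooth_on_normalize I_open dg_neq0 (smooth_on_derive1 g_smooth)).
split.
- exact: T_smooth.
- exact: (smooth_on_normalize I_open dT_neq0 (smooth_on_derive1 T_smooth)).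
- by move=> s Is; apply: dot_normalize; exact: dg_neq0.
- by move=> s Is; apply: dot_normalize; exact: dT_neq0.
- exact: erefl.
- by move=> s Is; apply: enorm_gt0; exact: dT_neq0.
- by move=> s Is; rewrite /curvature /frenetN enormK.
- exact: erefl.
Qed.

(** * From slant helices to general helices *)

Lemma constant_angleP (R : realType) (I : set R) (N : R -> 'rV[R]_3)
    (u : 'rV[R]_3) :
    (forall s, I s -> dot (N s) (N s) = 1) -> u != 0 ->
  constant_on I (fun s => angle (N s) u) <->
  constant_on I (fun s => dot (N s) u).
Proof.
move=> NN u_neq0; split=> -[c Nu]; last first.
  exists (acos (c / enorm u)) => s Is.
  by rewrite /angle (Nu s Is) {1}/enorm NN// sqrtr1 mul1r.
have [[s0 Is0]|I0] := pselect (exists s, I s); last first.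
  by exists 0 => s Is; case: I0; exists s.
exists (dot (N s0) u) => s Is.
by apply: (angle_inj (NN s Is) (NN s0 Is0) u_neq0); rewrite !Nu.
Qed.

Section binormal_indicatrix_frame.
Context {R : realType} (I : set R) (T N B : R -> 'rV[R]_3) (kappa tau : R -> R).
Hypothesis I_open : open I.
Hypothesis I_itv : is_interval I.
Hypothesis frame : Frenet_frame I T N B kappa tau.
Hypothesis tau_neq0 : forall s, I s -> tau s != 0.

Lemma frame_dB_neq0 s : I s -> derive1 B s != 0.
Proof.
move=> Is; rewrite (frame_dB I_open frame)// scaler_eq0 oppr_eq0.
by rewrite (negPf (tau_neq0 Is))/= -dot_eq0 (frame_NN frame)// oner_eq0.
Qed.

(** Normalizing B' = - tau N leaves N up to the sign of - tau, which is constant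
    on the interval I. *)
Lemma frenetT_binormal :
  exists2 e, e != 0 & forall s, I s -> frenetT B s = e *: N s.
Proof.
have [[s0 Is0]|I0] := pselect (exists s, I s); last first.
  by exists 1 => [|s Is]; [exact: oner_neq0|case: I0; exists s].
exists (- Num.sg (tau s0)); first by rewrite oppr_eq0 sgr_eq0 tau_neq0.
move=> s Is; rewrite /frenetT (frame_dB I_open frame)//.
rewrite normalizeZ_unit ?(frame_NN frame)// sgrN; congr (- _ *: _).
have tau_drv := frame_tau_derivable I_open frame.
exact: (nonvanishing_sg_constant I_itv tau_drv tau_neq0).
Qed.

(** The unit tangent of the curve B is a constant multiple of N, so this is
    Lancret's theorem for B. *)
Lemma constant_dot_normalP :
  (exists2 u, u != 0 & constant_on I (fun s => dot (N s) u)) <->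
  constant_on I (fun s =>
    enorm (derive1 (frenetB B) s) / enorm (derive1 (frenetT B) s)).
Proof.
have [e e_neq0 TB_E] := frenetT_binormal.
have dTB_neq0 s : I s -> derive1 (frenetT B) s != 0.
  move=> Is; have N_s := smooth_on_is_derive (frame_N_smooth frame) Is.
  rewrite (derive1_eq_on I_open Is TB_E) derive1E.
  have [_ ->] := is_deriveZ e N_s.
  by rewrite scaler_eq0 negb_or e_neq0 (frame_dN_neq0 I_open frame).
have frameB := frenet_Frenet_frame I_open (frame_B_smooth I_open frame)
  frame_dB_neq0 dTB_neq0.
apply: (iff_trans _ (Lancret I_open frameB I_itv)).
split=> -[u u_neq0 [c cu]]; exists u => //.
  by exists (e * c) => s Is; rewrite TB_E// dotZl cu.
by exists (e^-1 * c) => s Is; rewrite -(cu s Is) TB_E// dotZl mulKf.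
Qed.

End binormal_indicatrix_frame.

Unset Implicit Arguments.

Theorem theorem10 (R : realType) (I : set R) (alpha : R -> 'rV[R]_3)
  (I_open : open I) (I_itv : is_interval I)
  (alpha_smooth : smooth_on I alpha)
  (alpha_unit : unit_speed_on I alpha)
  (kappa_neq0 : forall s : R, I s -> curvature alpha s != 0)
  (tau_neq0 : forall s : R, I s -> torsion alpha s != 0) :
  let Btilde := binormal_indicatrix alpha in
  let Tstar := frenetT Btilde in
  let Bstar := frenetB Btilde in
  slant_helix I alpha <->
  constant_on I (fun s => enorm (derive1 Bstar s) / enorm (derive1 Tstar s)).
Proof.
move=> Btilde Tstar Bstar.
have alpha_regular s : I s -> derive1 alpha s != 0.
  by move=> Is; rewrite -enorm_eq0 alpha_unit// oner_eq0.
have T_regular s : I s -> derive1 (frenetT alpha) s != 0.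
  by move=> Is; rewrite -enorm_eq0 kappa_neq0.
have frame := frenet_Frenet_frame I_open alpha_smooth alpha_regular T_regular.
have normalP := constant_dot_normalP I_open I_itv frame tau_neq0.
have NN := frame_NN frame.
apply: (iff_trans _ normalP).
by split=> -[u u_neq0 cu]; exists u => //; apply/(constant_angleP NN u_neq0).
Qed.
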